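(* Let $v\ge4$. As formal power series in $y$, \[1+\sum_{d=1}^\infty \sum_{D \in \mathcal{D}_{v,d}(132,312)} x^{des(\pi_D)}y^d = \frac{1-yx}{1-y(1+x)}.\]
   Context: A diamond with $v$ vertices ($v\ge4$) is the poset with a least element, a greatest element, and $v-2$ pairwise incomparable middle elements (in a fixed left-to-right order) strictly between them. $\mathcal{D}_{v,d}$ is the set of labellings of $d$ diamonds (placed left to right) by $1,\dots,vd$, each label used once, such that in each diamond least label $<$ each middle label $<$ greatest label. For $D\in\mathcal{D}_{v,d}$, $\pi_D$ is the permutation obtained by reading the diamonds left to right and, within each diamond, the least element, then the middle elements left to right, then the greatest element. $\mathcal{D}_{v,d}(P)$ is the set of $D$ with $\pi_D$ avoiding every classical pattern in $P$. $des(\pi)$ is the number of $i$ with $\pi_i>\pi_{i+1}$. *)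

(* Defs.v *)
From mathcomp Require Import all_boot all_order all_algebra.

Set Implicit Arguments.
Unset Strict Implicit.
Unset Printing Implicit Defensive.

Import GRing.Theory.

(* Permutations are in one-line notation, as sequences over nat. *)

Definition order_iso (s t : seq nat) : bool :=
  (size s == size t) &&
  [forall i : 'I_(size s), forall j : 'I_(size s),
     (nth 0 s i < nth 0 s j) == (nth 0 t i < nth 0 t j)].

(* The masks of length [size s] select exactly the subsequences of [s]. *)
Definition contains_pattern (p s : seq nat) : bool :=
  [exists m : (size s).-tuple bool, order_iso p (mask m s)].

Definition avoids (P : seq (seq nat)) (s : seq nat) : bool :=
  all (fun p => ~~ contains_pattern p s) P.

Definition des (s : seq nat) : nat :=
  #|[set i : 'I_(size s).-1 | nth 0 s i.+1 < nth 0 s i]|.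

(* The vertices of the diamond with v vertices are 'I_v: 0 is the least element,
   v.-1 the greatest, and 1, ..., v.-2 the middle elements from left to right. *)
Definition diamond_least (v : nat) (i : 'I_v) : bool := i == 0 :> nat.
Definition diamond_greatest (v : nat) (i : 'I_v) : bool := i == v.-1 :> nat.
Definition diamond_middle (v : nat) (i : 'I_v) : bool :=
  ~~ diamond_least i && ~~ diamond_greatest i.

Definition diamond_lt (v : nat) (i j : 'I_v) : bool :=
  [|| diamond_least i && diamond_middle j,
      diamond_middle i && diamond_greatest j
    | diamond_least i && diamond_greatest j].

(* [D (k, i)] determines the label of vertex i of the k-th diamond. *)
Definition labelling (v d : nat) := {ffun 'I_d * 'I_v -> 'I_(v * d)}.

(* The labels are 1, ..., v * d, hence the successor. *)
Definition label (v d : nat) (D : labelling v d) (k : 'I_d) (i : 'I_v) : nat :=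
  (D (k, i)).+1.

(* There are as many labels as vertices, so injectivity means that each label
   is used exactly once. *)
Definition diamonds (v d : nat) : {set labelling v d} :=
  [set D : labelling v d | injectiveb D &&
     [forall k : 'I_d, forall i : 'I_v, forall j : 'I_v,
        diamond_lt i j ==> (label D k i < label D k j)]].

Definition reading (v d : nat) (D : labelling v d) : seq nat :=
  [seq label D k i | k <- enum 'I_d, i <- enum 'I_v].

Definition diamonds_avoiding (v d : nat) (P : seq (seq nat)) :
    {set labelling v d} :=
  [set D in diamonds v d | avoids P (reading D)].

Local Open Scope ring_scope.

(* Formal power series in one variable, as coefficient sequences; equality of
   series is [=1]. *)
Definition fps (R : Type) := nat -> R.

Section FormalPowerSeries.
Variable R : comUnitRingType.
Implicit Types a b : fps R.

Definition fpsC (c : R) : fps R := fun n => if n == 0%N then c else 0.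
Definition fpsX : fps R := fun n => (n == 1%N)%:R.
Definition fps_add a b : fps R := fun n => a n + b n.
Definition fps_sub a b : fps R := fun n => a n - b n.
Definition fps_mul a b : fps R := fun n => \sum_(i < n.+1) a i * b (n - i)%N.

(* The first n coefficients of the inverse, which is correct when the constant
   term is a unit; see fps_mulV below. *)
Fixpoint fps_inv_seq a (n : nat) : seq R :=
  if n is m.+1 then
    let s := fps_inv_seq a m in
    rcons s ((a 0%N)^-1 *
      ((m == 0%N)%:R - \sum_(i < m) a (m - i)%N * s`_i))
  else [::].

Definition fps_inv a : fps R := fun n => (fps_inv_seq a n.+1)`_n.
Definition fps_div a b : fps R := fps_mul a (fps_inv b).

Lemma size_fps_inv_seq a n : size (fps_inv_seq a n) = n.
Proof. by elim: n => //= n IHn; rewrite size_rcons IHn. Qed.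

Lemma nth_fps_inv_seq a n i : (i < n)%N -> (fps_inv_seq a n)`_i = fps_inv a i.
Proof.
elim: n => // n IHn; rewrite ltnS leq_eqVlt => /orP[/eqP-> //|lt_in].
by rewrite /= nth_rcons size_fps_inv_seq lt_in IHn.
Qed.

Lemma fps_mulV a : a 0%N \is a GRing.unit -> fps_mul a (fps_inv a) =1 fpsC 1.
Proof.
move=> a0U n; rewrite /fps_mul big_ord_recl subn0 {1}/fps_inv /=.
rewrite nth_rcons size_fps_inv_seq ltnn eqxx mulrA divrr // mul1r.
set s1 := \sum_(_ < _) _; set s2 := \sum_(_ < _) _.
have -> : s1 = s2.
  rewrite /s1 (reindex_inj rev_ord_inj) /=; apply: eq_bigr => i _.
  rewrite nth_fps_inv_seq ?ltn_subrL ?(leq_ltn_trans _ (ltn_ord i)) //.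
  by rewrite subKn // /bump leq0n add1n.
by rewrite subrK /fpsC; case: (n == 0%N).
Qed.

End FormalPowerSeries.

(* 1 + \sum_(d >= 1) \sum_(D in D_{v,d}(P)) x^des(pi_D) y^d, a series in y over
   Z[x], where x is the indeterminate 'X of {poly int}. *)
Definition diamond_des_series (v : nat) (P : seq (seq nat)) : fps {poly int} :=
  fps_add (fpsC 1)
    (fun d => if (1 <= d)%N
              then \sum_(D in diamonds_avoiding v d P) 'X^(des (reading D))
              else 0).

(* Main.v *)
Require Import Defs.
From mathcomp Require Import all_boot all_order all_algebra.
From mathcomp Require Import zify ring.

Set Implicit Arguments.
Unset Strict Implicit.
Unset Printing Implicit Defensive.

Import GRing.Theory.
Local Open Scope ring_scope.

(** A word avoids 132 and 312 exactly when each entry lies above all the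
    preceding ones or below all of them.  In a diamond every vertex but the
    least one has a smaller label to its left, so it is a new maximum; only the
    least vertex of a diamond other than the first is free to be a new minimum
    or a new maximum.  The set [B] of diamonds starting with a new minimum
    determines the relative order of the labels, hence the labelling, and is
    arbitrary; the descents are precisely the steps into these diamonds.  Thus
    the coefficient of y^(n+1) is the sum of x^#|B| over all subsets [B] of an
    n-element set, that is (1 + x)^n. *)

(** * Pattern containment by positions, and ranks of injective labellings *)

Section Preliminaries.
Local Open Scope nat_scope.

Lemma sorted_ltn_subseq_iota (l : seq nat) (n : nat) :
  sorted ltn l -> all (fun i => i < n) l -> subseq l (iota 0 n).
Proof.
move=> sl /allP ln.
suff -> : l = filter (fun i => i \in l) (iota 0 n) by apply: filter_subseq.
apply: (irr_sorted_eq ltn_trans ltnn) => //.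
  by apply: (sorted_filter ltn_trans); apply: iota_ltn_sorted.
move=> i; rewrite mem_filter mem_iota /= add0n.
by case il: (i \in l) => //=; rewrite ln.
Qed.

(** Masks are traded for increasing lists of positions, the form in which a pattern of length three
    can be unfolded. *)
Lemma contains_patternP (p s : seq nat) :
  reflect (exists l, [/\ sorted ltn l, all (fun i => i < size s) l
                       & order_iso p [seq nth 0 s i | i <- l]])
          (contains_pattern p s).
Proof.
apply: (iffP existsP) => [[m iso_m]|[l [sl ln iso_l]]].
  exists (mask m (iota 0 (size s))); split.
  - apply: (subseq_sorted ltn_trans) (iota_ltn_sorted 0 (size s)).
    exact: mask_subseq.
  - by apply/allP => i /mem_mask; rewrite mem_iota.
  - by rewrite map_mask -/(mkseq _ _) mkseq_nth.
have /subseqP[m sm def_l] := sorted_ltn_subseq_iota sl ln.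
have sm' : size m == size s by rewrite sm size_iota.
exists (Tuple sm') => /=.
by rewrite -{1}(mkseq_nth 0 s) /mkseq -map_mask -def_l.
Qed.

Lemma order_iso3 (x y z a b c : nat) :
  order_iso [:: x; y; z] [:: a; b; c] =
  [&& (x < y) == (a < b), (y < x) == (b < a), (x < z) == (a < c),
      (z < x) == (c < a), (y < z) == (b < c) & (z < y) == (c < b)].
Proof.
apply/idP/idP.
  move=> /andP[_ /forallP H].
  have E (i j : 'I_3) := eqP (forallP (H i) j).
  have o1 : 1 < 3 by []; have o2 : 2 < 3 by [].
  have /= -> := E ord0 (Ordinal o1); have /= -> := E (Ordinal o1) ord0.
  have /= -> := E ord0 (Ordinal o2); have /= -> := E (Ordinal o2) ord0.
  have /= -> := E (Ordinal o1) (Ordinal o2).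
  have /= -> := E (Ordinal o2) (Ordinal o1).
  by rewrite !eqxx.
case/and5P=> ? ? ? ? /andP[? ?]; apply/andP; split=> //.
by apply/forallP=> -[[|[|[|i]]] //= lti]; apply/forallP=> -[[|[|[|j]]] //= ltj];
  rewrite ?ltnn.
Qed.

Lemma contains_pattern3 (x y z : nat) (s : seq nat) :
  contains_pattern [:: x; y; z] s <->
  exists i j k, [/\ i < j, j < k, k < size s &
    order_iso [:: x; y; z] [:: nth 0 s i; nth 0 s j; nth 0 s k]].
Proof.
split.
  move=> /contains_patternP[l [+ + iso_l]].
  have : size l = 3.
    by have /andP[/eqP] := iso_l; rewrite size_map.
  case: l iso_l => [|i [|j [|k []]]] //= iso_l _.
  by move=> /and3P[ij jk _] /and4P[_ _ ks _]; exists i, j, k.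
move=> [i [j [k [ij jk ks iso]]]]; apply/contains_patternP.
exists [:: i; j; k]; split=> //=; first by rewrite ij jk.
by rewrite ks (ltn_trans jk) // (ltn_trans ij) // (ltn_trans jk).
Qed.

(** In both patterns the last entry has the middle value; the two orders of the smaller and the
    larger entry before it give 132 and 312. Hence [i] and [j] are left unordered. *)
Lemma avoids_132_312P (s : seq nat) :
  reflect (forall i j k, i < k -> j < k -> k < size s ->
             ~~ (nth 0 s i < nth 0 s k < nth 0 s j))
          (avoids [:: [:: 1; 3; 2]; [:: 3; 1; 2]] s).
Proof.
rewrite /avoids /= andbT; apply: (iffP andP) => [[av1 av2] i j k ik jk ks|H].
  apply/negP => /andP[lt1 lt2].
  case: (ltngtP i j) => [ij|ji|eij]; last by move: lt1 lt2; rewrite eij; lia.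
    by case/negP: av1; apply/contains_pattern3; exists i, j, k;
      rewrite order_iso3; split=> //; lia.
  by case/negP: av2; apply/contains_pattern3; exists j, i, k;
    rewrite order_iso3; split=> //; lia.
split; apply/negP => /contains_pattern3[i [j [k [ij jk ks]]]];
  rewrite order_iso3.
  by have := H i j k (ltn_trans ij jk) jk ks; lia.
by have := H j i k jk (ltn_trans ij jk) ks; lia.
Qed.

Lemma nth_allpairs (S T R : Type) (f : S -> T -> R) (x : S) (y : T) (z : R)
    (s : seq S) (t : seq T) (k i : nat) :
  k < size s -> i < size t ->
  nth z [seq f a b | a <- s, b <- t] (k * size t + i) =
  f (nth x s k) (nth y t i).
Proof.
elim: s k => [//|a s IHs] [|k] /= ks it; rewrite nth_cat size_map.
  by rewrite mul0n add0n it (nth_map y).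
by rewrite mulSn -addnA ltnNge leq_addr /= addKn IHs.
Qed.

(** By cardinality [f] is a bijection, so every value under [f p] is attained exactly once. Thus the
    relative order of the labels determines them. *)
Lemma injective_rank (T : finType) (m : nat) (f : T -> 'I_m) (p : T) :
  injective f -> #|T| = m -> #|[set q | f q < f p]| = f p.
Proof.
move=> f_inj cT; rewrite -(card_imset _ f_inj).
have [g gK fK] : bijective f by apply: inj_card_bij; rewrite ?cT ?card_ord.
transitivity #|[set x : 'I_m | x < f p]|.
  apply: eq_card => x; apply/imsetP/idP => [[q]|].
    by rewrite !inE => fq ->.
  by rewrite inE => lt_x; exists (g x); rewrite ?inE fK.
have le_m : f p <= m by apply: ltnW.
have widen_inj : injective (widen_ord le_m).
  by move=> y z /(congr1 val) /= /val_inj.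
rewrite -[RHS]card_ord -(card_imset _ widen_inj).
apply: eq_card => x; rewrite inE; apply/idP/imsetP => [lt_x|[y _ ->]] //=.
by exists (Ordinal lt_x) => //; apply: val_inj.
Qed.

End Preliminaries.

(** * The bijection between avoiding labellings and subsets of ['I_n] *)

Section Diamonds.
Local Open Scope nat_scope.
Variables (v n : nat).
Hypothesis v_gt1 : 1 < v.

Let vertex := ('I_n.+1 * 'I_v)%type.
Implicit Types (p q r : vertex) (B : {set 'I_n}) (D : labelling v n.+1).

Definition pos p : nat := p.1 * v + p.2.

Lemma v_gt0 : 0 < v. Proof. exact: ltnW. Qed.

Definition least (k : 'I_n.+1) : vertex := (k, Ordinal v_gt0).

Lemma pos_inj : injective pos.
Proof.
move=> [k i] [l j]; rewrite /pos /= => e.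
have ek : k = l :> nat.
  by have := congr1 (divn^~ v) e; rewrite !divnMDl ?v_gt0 // !divn_small ?addn0.
by move: e; rewrite ek => /addnI ei; congr pair; apply: val_inj.
Qed.

Lemma pos_lt p : pos p < n.+1 * v.
Proof.
case: p => k i; rewrite /pos /=; apply: (@leq_trans (k.+1 * v)).
  by rewrite mulSn addnC ltn_add2r.
by rewrite leq_pmul2r ?v_gt0.
Qed.

Lemma posP (m : nat) : m < n.+1 * v -> exists p, m = pos p.
Proof.
move=> m_lt.
have k_lt : m %/ v < n.+1 by rewrite ltn_divLR ?v_gt0.
have i_lt : m %% v < v by rewrite ltn_mod v_gt0.
by exists (Ordinal k_lt, Ordinal i_lt); rewrite /pos /= -divn_eq.
Qed.

Lemma size_reading D : size (reading D) = n.+1 * v.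
Proof. by rewrite size_allpairs -!cardE !card_ord. Qed.

Lemma nth_reading D p : nth 0 (reading D) (pos p) = (D p).+1.
Proof.
case: p => k i; have := @nth_allpairs _ _ _ (label D) k i 0
  (enum 'I_n.+1) (enum 'I_v) k i.
by rewrite -!cardE !card_ord !nth_ord_enum => ->.
Qed.

Lemma avoids_readingP D :
  reflect (forall p q r, pos p < pos r -> pos q < pos r ->
             ~~ (D p < D r < D q))
          (avoids [:: [:: 1; 3; 2]; [:: 3; 1; 2]] (reading D)).
Proof.
apply: (iffP (avoids_132_312P _)) => [H p q r pr qr|H i j k ik jk].
  have := H _ _ _ pr qr; rewrite size_reading !nth_reading !ltnS.
  by apply; apply: pos_lt.
rewrite size_reading => k_lt.
have [p def_i] := posP (ltn_trans ik k_lt).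
have [q def_j] := posP (ltn_trans jk k_lt).
have [r def_k] := posP k_lt.
by move: ik jk; rewrite def_i def_j def_k !nth_reading !ltnS; apply: H.
Qed.

Lemma diamond_lt_ltn (i j : 'I_v) : diamond_lt i j -> i < j.
Proof.
rewrite /diamond_lt /diamond_middle /diamond_least /diamond_greatest.
by have := ltn_ord i; have := ltn_ord j; lia.
Qed.

Lemma diamond_lt_least (i j : 'I_v) : i = 0 :> nat -> 0 < j -> diamond_lt i j.
Proof.
rewrite /diamond_lt /diamond_middle /diamond_least /diamond_greatest.
by have := ltn_ord i; have := ltn_ord j; lia.
Qed.

(* Diamond 0 has no predecessor, so [B] indexes the diamonds 1, ..., n. *)
Definition new_min B p : bool :=
  (p.2 == 0 :> nat) && (if unlift ord0 p.1 is Some j then j \in B else false).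

(** The intended order of the labels. The vertex read later decides: a new minimum falls under
    everything before it, any other vertex rises above it. *)
Definition below B q p : bool :=
  (pos q < pos p) && ~~ new_min B p || (pos p < pos q) && new_min B q.

(** Counting predecessors turns the strict total order [below B] into labels starting from 0, as
    [labelling] stores them. *)
Definition rank B p : nat := #|[set q | below B q p]|.

Lemma belowxx B p : below B p p = false.
Proof. by rewrite /below ltnn. Qed.

Lemma below_trans B q p r : below B p q -> below B q r -> below B p r.
Proof.
rewrite /below; case: (ltngtP (pos p) (pos r)) => [pr|rp|/pos_inj ->] /=;
  by case: (new_min B q); case: (new_min B r) => //=; case: (new_min B p); lia.
Qed.

Lemma below_total B p q : p != q -> below B p q || below B q p.
Proof.
rewrite -(inj_eq pos_inj) /below.
by case: new_min; case: new_min; lia.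
Qed.

Lemma rank_ltn_ord B p : rank B p < v * n.+1.
Proof.
have <- : #|{: vertex}| = v * n.+1 by rewrite card_prod !card_ord mulnC.
rewrite -cardsT; apply: proper_card; rewrite properT.
by apply/eqP => e; have := in_setT p; rewrite -e inE belowxx.
Qed.

Lemma below_rank B p q : below B p q -> rank B p < rank B q.
Proof.
move=> pq; apply: proper_card; rewrite properE; apply/andP; split.
  by apply/subsetP => r; rewrite !inE => /below_trans; apply.
by apply/subsetPn; exists p; rewrite !inE ?belowxx.
Qed.

Lemma rank_ltn B p q : (rank B p < rank B q) = below B p q.
Proof.
apply/idP/idP => [lt_pq|]; last exact: below_rank.
have neq : p != q by apply: contraTneq lt_pq => ->; rewrite ltnn.
have /orP[//|/below_rank] := below_total B neq.
by move=> /ltn_trans/(_ lt_pq); rewrite ltnn.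
Qed.

Definition labelling_of B : labelling v n.+1 :=
  [ffun p => Ordinal (rank_ltn_ord B p)].

Lemma labelling_of_ltn B p q :
  (labelling_of B p < labelling_of B q) = below B p q.
Proof. by rewrite !ffunE /= rank_ltn. Qed.

(** In an avoiding word an entry is above or below all earlier ones, so comparing it with the very
    first entry tells which. *)
Definition descents_of D : {set 'I_n} :=
  [set j | D (least (lift ord0 j)) < D (least ord0)].

Lemma new_min_least B (j : 'I_n) : new_min B (least (lift ord0 j)) = (j \in B).
Proof. by rewrite /new_min liftK. Qed.

Lemma pos_least0 : pos (least ord0) = 0. Proof. by []. Qed.

Lemma labelling_ofK : cancel labelling_of descents_of.
Proof.
move=> B; apply/setP => j; rewrite inE labelling_of_ltn /below pos_least0.
rewrite new_min_least ltn0 /= /pos /= addn0 /bump add1n.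
by rewrite mulSn ltn_addr ?v_gt0.
Qed.

Lemma labelling_of_avoiding B :
  labelling_of B \in
    diamonds_avoiding v n.+1 [:: [:: 1; 3; 2]; [:: 3; 1; 2]].
Proof.
rewrite !inE -andbA; apply/and3P; split.
- apply/injectiveP => p q e; apply/eqP/negPn/negP => /(below_total B).
  by rewrite -!labelling_of_ltn e ltnn.
- apply/forallP => k; apply/forallP => i; apply/forallP => j; apply/implyP.
  (* Since [i < j], vertex [j] is not the least one, hence no new minimum. *)
  move=> /diamond_lt_ltn ij; rewrite ltnS labelling_of_ltn /below /new_min /=.
  by rewrite /pos /= ltn_add2l ij gtn_eqF ?(leq_ltn_trans _ ij).
- apply/avoids_readingP => p q r pr qr; rewrite !labelling_of_ltn /below.
  by case: new_min; case: new_min; lia.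
Qed.

Lemma descents_ofK D :
  D \in diamonds_avoiding v n.+1 [:: [:: 1; 3; 2]; [:: 3; 1; 2]] ->
  labelling_of (descents_of D) = D.
Proof.
rewrite !inE -andbA => /and3P[/injectiveP D_inj /forallP dD /avoids_readingP av].
set B := descents_of D.
have neqD p q : pos q < pos p -> D q != D p :> nat.
  by move=> qp; rewrite (inj_eq val_inj) (inj_eq D_inj); apply: contraTneq qp => ->;
    rewrite ltnn.
have ltD p q : pos q < pos p -> (D q < D p) = ~~ new_min B p.
  move=> qp; case: (boolP (new_min B p)) => /= [|notmin].
    case: p qp => k i qp; rewrite /new_min /=.
    case: unliftP => [j def_k|]; rewrite ?andbF // inE => /andP[/eqP i0 lt0].
    have def_p : least (lift ord0 j) = (k, i).
      by rewrite /least def_k; congr pair; apply: val_inj.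
    move: lt0; rewrite def_p => lt0.
    (* The label of [p] is under the first label; were it above that of [q], it would end a
       forbidden pattern. *)
    by have := av q (least ord0) _ qp (leq_trans _ qp); rewrite pos_least0 lt0;
      lia.
  (* One smaller label to the left suffices: avoidance then forbids any larger label to the left. *)
  suff [r rp ltr] : exists2 r, pos r < pos p & D r < D p.
    by have := av r q p rp qp; have := neqD _ _ qp; lia.
  case: p qp notmin => k i qp; rewrite /new_min /=.
  have [i_eq0|i_gt0] := posnP i.
    case: unliftP => [j def_k|def_k].
      rewrite inE -leqNgt => le0.
      have def_p : least (lift ord0 j) = (k, i).
        by rewrite /least def_k; congr pair; apply: val_inj.
      rewrite def_p in le0.
      have p_gt0 : pos (least ord0) < pos (k, i) by apply: leq_trans qp.
      exists (least ord0) => //.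
      by have := neqD _ _ p_gt0; lia.
    (* Here [p] is the first vertex of all, so no [q] precedes it. *)
    by move: qp; rewrite {2}/pos /= def_k i_eq0.
  move=> _; exists (least k); first by rewrite /pos /= ltn_add2l.
  have /forallP/(_ i)/implyP := forallP (dD k) (Ordinal v_gt0).
  by rewrite ltnS; apply; apply: diamond_lt_least.
have ltE q p : (D q < D p) = below B q p.
  rewrite /below; case: (ltngtP (pos q) (pos p)) => [qp|pq|/pos_inj ->] /=.
  - by rewrite ltD ?orbF.
  - by rewrite -[RHS]negbK -(ltD _ _ pq); have := neqD _ _ pq; lia.
  - by rewrite ltnn.
apply/ffunP => p; apply: val_inj; rewrite ffunE /=.
(* Both labellings induce the order [below B], and each label is its rank in that order. *)
rewrite -(injective_rank p D_inj) ?card_prod ?card_ord 1?mulnC //.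
by apply: eq_card => q; rewrite !inE ltE.
Qed.

Lemma des_labelling_of B : des (reading (labelling_of B)) = #|B|.
Proof.
pose s := reading (labelling_of B).
have desE p q : pos q = (pos p).+1 ->
    (nth 0 s (pos p).+1 < nth 0 s (pos p)) = new_min B q.
  move=> pq; rewrite -{1}pq !nth_reading ltnS labelling_of_ltn /below pq ltnSn.
  by rewrite ltnNge leqnSn.
(* Diamond [j.+1] starts at position [j.+1 * v]; the descent into it is indexed by the position just
   before, that of the preceding greatest vertex. *)
have step_lt (j : 'I_n) : (j.+1 * v).-1 < (size s).-1.
  by rewrite size_reading; have := ltn_ord j; nia.
pose step j := Ordinal (step_lt j).
have step_inj : injective step.
  move=> i j /(congr1 val) /= e; apply: val_inj => /=.
  by move: e; nia.
rewrite -(card_imset B step_inj); apply: eq_card => m; rewrite inE.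
have m_lt : m.+1 < n.+1 * v.
  by have := ltn_ord m; rewrite {2}size_reading; lia.
have [p def_m] := posP (ltnW m_lt); have [q def_m1] := posP m_lt.
have -> : (nth 0 s m.+1 < nth 0 s m) = new_min B q.
  by rewrite -(desE p q) -?def_m.
apply/idP/imsetP => [|[j jB def_j]].
  rewrite /new_min; case: q def_m1 => k i /=; case: unliftP => [j ->|->];
    rewrite ?andbF // => + /andP[/eqP i0 jB].
  rewrite /pos /= i0 /bump add1n addn0 => e.
  by exists j => //; apply: val_inj => /=; rewrite -e.
suff -> : q = least (lift ord0 j) by rewrite new_min_least.
apply: pos_inj; rewrite -def_m1 def_j /pos /= /bump add1n addn0 prednK //.
by rewrite mulSn ltn_addr ?v_gt0.
Qed.

Lemma sum_des_avoiding (R : comNzRingType) (x : R) :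
  (\sum_(D in diamonds_avoiding v n.+1 [:: [:: 1; 3; 2]%N; [:: 3; 1; 2]%N])
     x ^+ des (reading D) = (1 + x) ^+ n)%R.
Proof.
rewrite (reindex_onto labelling_of descents_of) => [|D]; last exact: descents_ofK.
transitivity (\sum_(B : {set 'I_n}) x ^+ #|B|)%R.
  by apply: eq_big => B; rewrite ?labelling_of_avoiding ?labelling_ofK ?eqxx //
    des_labelling_of.
(* Expanding the product of [n] factors [x + 1] picks [x] on a subset and 1 on its complement. *)
have := bigA_distr 1%R +%R (fun _ : 'I_n => x) (fun _ => 1%R).
rewrite prodr_const card_ord addrC => ->.
by apply: eq_big => // B _; rewrite -big_mkcond prodr_const.
Qed.

End Diamonds.

(** * Power series with a linear denominator *)

Section LinearDenominator.
Variable R : comUnitRingType.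

Lemma fps_subXC (c : R) (i : nat) :
  fps_sub (fpsC 1) (fps_mul (fpsX R) (fpsC c)) i =
  if i is j.+1 then if j is 0%N then - c else 0 else 1.
Proof.
rewrite /fps_sub /fps_mul /fpsC /fpsX.
case: i => [|i] /=; first by rewrite big_ord1 mul0r subr0.
rewrite !big_ord_recl /= mul0r add0r mul1r subSS subn0 big1 ?addr0 => [|j _].
  by case: i => [|i] /=; rewrite !add0r ?addr0 ?oppr0.
by rewrite mul0r.
Qed.

Lemma fps_mul_subXC (c : R) (a : fps R) (m : nat) :
  fps_mul (fps_sub (fpsC 1) (fps_mul (fpsX R) (fpsC c))) a m =
  a m - (if m is k.+1 then c * a k else 0).
Proof.
rewrite {1}/fps_mul big_ord_recl fps_subXC mul1r subn0.
case: m => [|m]; first by rewrite big_ord0 addr0 subr0.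
rewrite big_ord_recl fps_subXC /= mulNr subSS subn0 big1 ?addr0 // => j _.
by rewrite fps_subXC mul0r.
Qed.

(** Geometric series: multiplying the inverse by the linear factor gives 1, so each coefficient is
    [c] times the previous one. *)
Lemma fps_inv_subXC (c : R) (m : nat) :
  fps_inv (fps_sub (fpsC 1) (fps_mul (fpsX R) (fpsC c))) m = c ^+ m.
Proof.
set a := fps_sub _ _; have a0 : a 0%N \is a GRing.unit.
  by rewrite /a fps_subXC unitr1.
elim: m => [|m IHm]; [have := fps_mulV a0 0%N | have := fps_mulV a0 m.+1];
  rewrite fps_mul_subXC /fpsC /=; first by rewrite subr0.
by move/eqP; rewrite subr_eq0 IHm -exprS => /eqP.
Qed.

End LinearDenominator.

Theorem theorem3p5 (v : nat) (hv : (4 <= v)%N) :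
  diamond_des_series v [:: [:: 1; 3; 2]%N; [:: 3; 1; 2]%N] =1
  fps_div
    (fps_sub (fpsC 1) (fps_mul (fpsX _) (fpsC ('X : {poly int}))))
    (fps_sub (fpsC 1) (fps_mul (fpsX _) (fpsC (1 + 'X : {poly int})))).
Proof.
have v_gt1 : (1 < v)%N by apply: leq_trans hv.
move=> m; rewrite /fps_div fps_mul_subXC /diamond_des_series /fps_add /fpsC.
case: m => [|n] /=; first by rewrite fps_inv_subXC addr0 subr0.
(* With x for ['X], the coefficient of y^(n+1) on the right is (1 + x)^(n+1) - x (1 + x)^n = (1 +
   x)^n. *)
by rewrite sum_des_avoiding // !fps_inv_subXC exprS; ring.
Qed.
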